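(* For $n \ge 0$ let $L_n$ denote the number of (not necessarily closed) lambda terms in de Bruijn notation of size $n$. Let $\rho$ be the smallest positive root of $1-3z-z^2-z^3$ (so $\rho \approx 0.29559$ and $1/\rho \approx 3.38297$), and let $$C = \frac{-\sqrt{\rho\,\frac{3\rho^2+2\rho+3}{1-\rho}}}{2\rho\,\Gamma(-\tfrac12)} \approx 0.60676.$$ Then, as $n \to \infty$, $$L_n \sim \left(\frac{1}{\rho}\right)^n \frac{C}{n^{3/2}}.$$
   Context: Lambda terms in de Bruijn notation are generated by the grammar $M ::= \underline{0} \mid S\,n \mid \lambda M \mid M\,M$, where de Bruijn indices are $n ::= \underline{0} \mid S\,n$ (so the index $S^k\underline{0}$ may be used anywhere, terms need not be closed). The size is defined by $|\underline{0}| = 1$, $|S\,n| = |n|+1$, $|\lambda M| = |M|+1$, $|M_1 M_2| = |M_1|+|M_2|+1$. $\Gamma$ is the Euler Gamma function. *)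

(* Defs.v *)
From HB Require Import structures.
From mathcomp Require Import all_boot all_order all_algebra finmap.
From mathcomp Require Export all_classical all_reals all_analysis.

Set Implicit Arguments.
Unset Strict Implicit.
Unset Printing Implicit Defensive.

Import Order.TTheory GRing.Theory Num.Theory.
Import numFieldNormedType.Exports.

Local Open Scope classical_set_scope.
Local Open Scope ring_scope.

(* The grammar for indices, n ::= 0 | S n, is that of [nat]; [Var n] is the term
   made of the index n alone.  No scoping condition is imposed, so terms may be
   open. *)
Inductive term : Type :=
| Var of nat
| Lam of term
| App of term & term.

Fixpoint index_size (n : nat) : nat :=
  if n is n'.+1 then (index_size n' + 1)%N else 1%N.

Fixpoint term_size (M : term) : nat :=
  match M with
  | Var n => index_size n
  | Lam M1 => (term_size M1 + 1)%N
  | App M1 M2 => (term_size M1 + term_size M2 + 1)%N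
  end.

(* [fset_set] below requires a choiceType, obtained by encoding terms as trees. *)
Fixpoint tree_of_term (M : term) : GenTree.tree nat :=
  match M with
  | Var n => GenTree.Leaf n
  | Lam M1 => GenTree.Node 0 [:: tree_of_term M1]
  | App M1 M2 => GenTree.Node 1 [:: tree_of_term M1; tree_of_term M2]
  end.

Fixpoint term_of_tree (t : GenTree.tree nat) : option term :=
  match t with
  | GenTree.Leaf n => Some (Var n)
  | GenTree.Node 0 [:: t1] => omap Lam (term_of_tree t1)
  | GenTree.Node 1 [:: t1; t2] =>
      obind (fun M1 => omap (App M1) (term_of_tree t2)) (term_of_tree t1)
  | _ => None
  end.

Lemma tree_of_termK : pcancel tree_of_term term_of_tree.
Proof. by elim=> [n|M /= ->|M1 /= -> M2 /= ->]. Qed.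

HB.instance Definition _ := Countable.copy term (pcan_type tree_of_termK).

(* [fset_set] sends infinite sets to the empty finite set; by
   [finite_terms_of_size] this default value is never used here. *)
Definition L (n : nat) : nat := #|` fset_set [set M : term | term_size M = n]|.

Lemma finite_terms_of_size (n : nat) :
  finite_set [set M : term | term_size M = n].
Proof.
have index_sizeE k : index_size k = k.+1.
  by elim: k => //= k ->; rewrite addn1.
suff: finite_set [set M : term | (term_size M <= n)%N].
  by apply: sub_finite_set => M /= ->.
elim: n => [|n IHn].
  apply: (@sub_finite_set _ _ set0) => // -[k|M|M1 M2] /=.
  - by rewrite index_sizeE.
  - by rewrite addn1.
  - by rewrite addn1.
pose A := [set M : term | (term_size M <= n)%N].
apply: (@sub_finite_set _ _
  ((Var @` `I_n.+1) `|` (Lam @` A) `|` [set App M1 M2 | M1 in A & M2 in A])).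
  move=> [k|M|M1 M2] /=.
  - by rewrite index_sizeE => ltkn; left; left; exists k.
  - by rewrite addn1 ltnS => leMn; left; right; exists M.
  - rewrite addn1 ltnS => leMn; right; exists M1.
      exact: leq_trans (leq_addr _ _) leMn.
    by exists M2 => //; exact: leq_trans (leq_addl _ _) leMn.
rewrite !finite_setU; split; first split.
- exact/finite_image/finite_II.
- exact: finite_image.
- exact: finite_image2.
Qed.

(* Euler's integral for x > 0, extended to the negative non-integers by
   Gamma x = Gamma (x + 1) / x.  The number m of steps is the least one with
   x + m > 0; the value at the poles 0, -1, -2, ... is 0. *)
Definition Gamma (R : realType) (x : R) : R :=
  let m := Num.truncn (1 - x) in
  (\int[lebesgue_measure]_(t in `]0, +oo[)
      (t `^ (x + m%:R - 1) * expR (- t)))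
  / \prod_(k < m) (x + k%:R).

Definition smallest_positive_root (R : realType) (p : {poly R}) (r : R) : Prop :=
  [/\ 0 < r, root p r & forall s : R, 0 < s -> root p s -> r <= s].

(* Main.v *)
(* The generating function satisfies z L^2 - (1 - z) L + z / (1 - z) = 0, so
   F = (1 - z) - 2 z L is a square root of D = (1 - 3 z - z^2 - z^3) / (1 - z).
   Writing D = (1 - z / rho) W gives F = (1 - z / rho)^(1/2) B with B^2 = W,
   where the majorant method applied to B = 1 + y, 2 y = (W - 1) - y^2, shows
   that B converges absolutely at z = 1/3 > rho.  The coefficients of
   (1 - z)^(1/2) are - Gamma(n - 1/2) / (2 Gamma(1/2) n!), and log-convexity of
   Gamma makes them equivalent to - n^(-3/2) / (2 Gamma(1/2)).  Since B decays
   geometrically faster, dominated convergence in the Cauchy product multiplies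
   this equivalent by B(rho) = W(rho)^(1/2). *)
From HB Require Import structures.
Require Import Defs.
From mathcomp Require Import all_boot all_order all_algebra finmap.
From mathcomp Require Import all_classical all_reals all_analysis.
From mathcomp Require Import measurable_realfun.
From mathcomp Require Import ring lra zify.
Set Implicit Arguments.
Unset Strict Implicit.
Unset Printing Implicit Defensive.
Import Order.TTheory GRing.Theory Num.Theory.
Import numFieldNormedType.Exports.
Local Open Scope classical_set_scope.
Local Open Scope ring_scope.

(** * Counting lambda terms *)

Lemma index_sizeE (n : nat) : Defs.index_size n = n.+1.
Proof. by elim: n => //= n ->; rewrite addn1. Qed.

Lemma term_size_gt0 (M : term) : (0 < term_size M)%N.
Proof. by case: M => [n|M|M1 M2] /=; rewrite ?index_sizeE ?addn1. Qed.

Definition terms_of_size (n : nat) : seq term :=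
  fset_set [set M : term | term_size M = n].

Lemma mem_terms_of_size n M : (M \in terms_of_size n) = (term_size M == n).
Proof.
rewrite /terms_of_size in_fset_set; last exact: finite_terms_of_size.
by apply/idP/eqP => [|H]; rewrite inE /=.
Qed.

Lemma L_size (n : nat) (s : seq term) :
  uniq s -> (forall M, (M \in s) = (term_size M == n)) -> L n = size s.
Proof.
move=> us ms; apply/perm_size/uniq_perm => // M.
by rewrite ms mem_terms_of_size.
Qed.

Lemma L0 : L 0 = 0%N.
Proof.
rewrite (@L_size 0 [::]) // => M; rewrite in_nil.
by apply/esym/negbTE; rewrite -lt0n term_size_gt0.
Qed.

(** Classification by head constructor: the only index of size [n.+1] is [Var n], and the sizes of
    the two arguments of an application add up to [n]. *)
Lemma L_recl (n : nat) :
  L n.+1 = (1 + L n + \sum_(i < n.+1) L i * L (n - i))%N.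
Proof.
pose T := terms_of_size.
have uT k : uniq (T k) by exact: fset_uniq.
have szT k : size (T k) = L k by rewrite -(@L_size k (T k)) // => M; exact: mem_terms_of_size.
pose P := [seq (i, p) | i <- iota 0 n.+1, p <- [seq (M1, M2) | M1 <- T i, M2 <- T (n - i)%N]].
have uP : uniq [seq App x.2.1 x.2.2 | x <- P].
  rewrite map_inj_in_uniq.
    apply: allpairs_uniq_dep => [|i _|].
    - exact: iota_uniq.
    - by apply: allpairs_uniq => // -[? ?] [? ?] _ _.
    - by move=> [i p] [j q] _ _ /= [-> ->].
  (* The tag [i] is recovered from the first component, so dropping it keeps the map to applications
     injective on [P]. *)
  have szP i M1 M2 : (i, (M1, M2)) \in P -> i = term_size M1.
    case/allpairsPdep => [i' [p [_ ip [-> ep]]]]; move: ip; rewrite -ep.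
    case/allpairsPdep => [N1 [N2 [iN _ [eN _]]]]; move: iN.
    by rewrite -eN mem_terms_of_size => /eqP.
  by move=> [i [M1 M2]] [j [N1 N2]] /szP -> /szP -> /= [-> ->].
rewrite (@L_size n.+1 (Var n :: [seq Lam M | M <- T n] ++ [seq App x.2.1 x.2.2 | x <- P])).
- rewrite /= size_cat !size_map szT add1n addSn; congr (_ + _).+1.
  rewrite /P size_allpairs_dep sumnE big_map.
  rewrite -[iota 0 _]/(index_iota 0 n.+1) big_mkord.
  by apply: eq_bigr => i _; rewrite size_allpairs !szT.
- rewrite /= cat_uniq uP map_inj_uniq ?uT ?andbT; last by move=> ? ? [].
  apply/andP; split.
    rewrite mem_cat negb_or; apply/andP; split.
      by apply/mapP => -[].
    by apply/mapP => -[].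
  by apply/hasPn => _ /mapP[x _ ->]; apply/mapP => -[].
- move=> M; rewrite in_cons mem_cat.
  case: M => [k|M|M1 M2] /=.
  + rewrite index_sizeE eqSS.
    rewrite (negbTE (_ : Var k \notin [seq Lam M | M <- T n])); last by apply/mapP => -[].
    rewrite (negbTE (_ : Var k \notin [seq App x.2.1 x.2.2 | x <- P])); last by apply/mapP => -[].
    by rewrite !orbF; apply/eqP/eqP => [[]|->].
  + rewrite addn1 eqSS mem_map; last by move=> ? ? [].
    rewrite mem_terms_of_size.
    rewrite (negbTE (_ : Lam M \notin [seq App x.2.1 x.2.2 | x <- P])); last by apply/mapP => -[].
    by rewrite orbF; case: eqP.
  + rewrite addn1 eqSS.
    rewrite (negbTE (_ : App M1 M2 \notin [seq Lam M | M <- T n])); last by apply/mapP => -[].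
    case: (App M1 M2 =P Var n) => [//|_] /=.
    apply/mapP/eqP => [[x /allpairsPdep[i [p [+ + ->]]]]|H].
      rewrite mem_iota /= => lin /allpairsPdep[N1 [N2 [+ + ->]]] /= [-> ->].
      by rewrite !mem_terms_of_size => /eqP -> /eqP ->; lia.
    exists (term_size M1, (M1, M2)) => //.
    apply/allpairsPdep; exists (term_size M1), (M1, M2); split => //.
      by rewrite mem_iota; lia.
    apply/allpairsPdep; exists M1, M2; split => //; rewrite mem_terms_of_size //.
    by apply/eqP; lia.
Qed.

(** * Formal power series and the discriminant *)

Section Convolution.
Context {R : comNzRingType}.
Implicit Types (u v w : nat -> R) (c : R).

Definition convol u v : nat -> R := fun n => \sum_(i < n.+1) u i * v (n - i)%N.

Definition convol_one : nat -> R := fun n => (n == 0%N)%:R.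

(** Reduces identities between power series, coefficient by coefficient, to ring identities between
    truncating polynomials. *)
Lemma convol_coefM (p q : {poly R}) u v n :
  (forall i, (i <= n)%N -> p`_i = u i) -> (forall i, (i <= n)%N -> q`_i = v i) ->
  (p * q)`_n = convol u v n.
Proof.
move=> pu qv; rewrite coefM; apply: eq_bigr => i _.
by rewrite pu ?qv ?leq_subr // -ltnS.
Qed.

Lemma coef_trunc u n i : (i <= n)%N -> (\poly_(j < n.+1) u j)`_i = u i.
Proof. by move=> lin; rewrite coef_poly ltnS lin. Qed.

Lemma convolC : commutative convol.
Proof.
move=> u v; apply/funext => n.
rewrite -(convol_coefM (@coef_trunc u n) (@coef_trunc v n)) mulrC.
exact: convol_coefM (@coef_trunc v n) (@coef_trunc u n).
Qed.

Lemma convolA : associative convol.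
Proof.
move=> u v w; apply/funext => n.
pose p u := \poly_(j < n.+1) u j : {poly R}.
have pM u' v' i : (i <= n)%N -> (p u' * p v')`_i = convol u' v' i.
  move=> lin; apply: convol_coefM => j lji; exact: coef_trunc (leq_trans lji lin).
transitivity ((p u * (p v * p w))`_n).
  by apply/esym/convol_coefM; [exact: coef_trunc|exact: pM].
by rewrite mulrA; apply: convol_coefM; [exact: pM|exact: coef_trunc].
Qed.

Lemma convol1l : left_id convol_one convol.
Proof.
move=> u; apply/funext => n.
rewrite /convol big_ord_recl subn0 mul1r big1 ?addr0 // => i _.
by rewrite mul0r.
Qed.

HB.instance Definition _ :=
  Monoid.isComLaw.Build (nat -> R) convol_one convol convolA convolC convol1l.

(** The series $1/(1-cz)$, inverse of the series $1-cz$ encoded by [one_sub c]. *)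
Definition geom c : nat -> R := fun n => c ^+ n.

Definition one_sub c : nat -> R :=
  fun n => if n is m.+1 then if m is 0 then - c else 0 else 1.

Lemma convol_one_subS c u n : convol (one_sub c) u n.+1 = u n.+1 - c * u n.
Proof.
rewrite /convol 2!big_ord_recl big1 ?addr0 => [|i _]; last by rewrite mul0r.
by rewrite mul1r mulNr subn0 subn1.
Qed.

Lemma convol0 u v : convol u v 0 = u 0%N * v 0%N.
Proof. by rewrite /convol big_ord1. Qed.

Lemma convol_one_sub_geom c : convol (one_sub c) (geom c) = convol_one.
Proof.
apply/funext => -[|n]; first by rewrite convol0 mulr1.
by rewrite convol_one_subS /geom exprS subrr.
Qed.

Lemma convol_scale c u v n :
  convol (fun k => u k * c ^+ k) (fun k => v k * c ^+ k) n = convol u v n * c ^+ n.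
Proof.
rewrite /convol mulr_suml; apply: eq_bigr => i _.
by rewrite mulrACA -exprD subnKC // -ltnS.
Qed.

End Convolution.

(** * The power series of $(1-z)^{1/2}$ *)

Section Sqrt.
Context {R : numFieldType}.

(** Taylor coefficients of $F=(1-z)^{1/2}$; the ratio of consecutive terms encodes
    $(1-z)F'=-F/2$. *)
Fixpoint sqrt_coef (n : nat) : R :=
  if n is m.+1 then sqrt_coef m * ((m%:R - 2^-1) / m.+1%:R) else 1.

Lemma sqrt_coefS n : n.+1%:R * sqrt_coef n.+1 = (n%:R - 2^-1) * sqrt_coef n.
Proof. by rewrite /= [RHS]mulrC [LHS]mulrC -mulrA divfK. Qed.

(* Coefficientwise form of the differential equation (1 - z) S' = - S
   for the square S of the series. *)
Lemma convol_sqrt_coefS n : n.+1%:R * convol sqrt_coef sqrt_coef n.+1 =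
  (n%:R - 1) * convol sqrt_coef sqrt_coef n.
Proof.
(* The identity $z(F^2)'=2zF'F$ in coefficients, by the symmetry $i \leftrightarrow m-i$. *)
have wsum (m : nat) : m%:R * convol sqrt_coef sqrt_coef m =
    2 * \sum_(i < m.+1) i%:R * sqrt_coef i * sqrt_coef (m - i).
  rewrite [RHS]mulr_natl mulr2n.
  rewrite [X in _ = _ + X](reindex_inj rev_ord_inj) -big_split mulr_sumr.
  apply: eq_bigr => i _ /=; rewrite subSS.
  have lim : (i <= m)%N by rewrite -ltnS.
  have -> : m%:R = i%:R + (m - i)%:R :> R by rewrite -natrD subnKC.
  by rewrite subKn //; ring.
rewrite wsum big_ord_recl mul0r mul0r add0r.
under eq_bigr do rewrite /= sqrt_coefS subSS.
have -> : (n%:R - 1) * convol sqrt_coef sqrt_coef n =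
    2 * (\sum_(i < n.+1) i%:R * sqrt_coef i * sqrt_coef (n - i) -
      2^-1 * convol sqrt_coef sqrt_coef n) by rewrite mulrBr -wsum; field.
congr (_ * _).
rewrite mulr_sumr -sumrB; apply: eq_bigr => i _.
by rewrite mulrBl mulrBl mulrA.
Qed.

(** The factor $n-1$ of the recurrence vanishes at $n=1$, which kills every coefficient from degree
    2 on. *)
Lemma convol_sqrt_coef : convol sqrt_coef sqrt_coef = one_sub 1.
Proof.
have S1 : convol sqrt_coef sqrt_coef 1 = -1.
  have := convol_sqrt_coefS 0; rewrite mul1r convol0 !mulr1 sub0r; exact.
apply/funext => -[|[|n]] //=; first by rewrite convol0 mulr1.
elim: n => [|n IHn].
  apply/(mulfI (_ : 2 != 0 :> R)); first by rewrite pnatr_eq0.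
  by rewrite convol_sqrt_coefS subrr mul0r mulr0.
apply/(mulfI (_ : n.+3%:R != 0 :> R)); first by rewrite pnatr_eq0.
by rewrite convol_sqrt_coefS IHn !mulr0.
Qed.

Definition sqrt_one_sub (c : R) : nat -> R := fun n => sqrt_coef n * c ^+ n.

Lemma convol_sqrt_one_sub c :
  convol (sqrt_one_sub c) (sqrt_one_sub c) = one_sub c.
Proof.
apply/funext => n; rewrite convol_scale convol_sqrt_coef.
by case: n => [|[|n]] /=; rewrite ?mulr1 ?mul0r // mulN1r.
Qed.

End Sqrt.

(** * The discriminant and its factor $1-z/\rho$ *)

Section Discriminant.
Context {R : realType}.

(* Coefficients of (1 - z) - 2 z L(z), the square root of the discriminant of
   the quadratic equation z L^2 - (1 - z) L + z / (1 - z) = 0. *)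
Definition root_discr (n : nat) : R :=
  if n is m.+1 then if m is 0 then -1 else - 2 * (L m)%:R else 1.

(** Coefficients of $(1-3z-z^2-z^3)/(1-z)$, that is, the partial sums of $1,-3,-1,-1,0,\dots$ *)
Definition discr (n : nat) : R :=
  match n with 0 => 1 | 1 => -2 | 2 => -3 | _ => -4 end.

Lemma convol_root_discr : convol root_discr root_discr = discr.
Proof.
apply/funext => n.
pose l : {poly R} := \poly_(i < n.+1) (L i)%:R.
have lE i : (i <= n)%N -> l`_i = (L i)%:R by exact: coef_trunc.
pose f : {poly R} := 1 - 'X - 2 *: ('X * l).
have fE i : (i <= n)%N -> f`_i = root_discr i.
  move=> lin; rewrite !coefB coef1 coefX coefZ coefXM.
  case: i lin => [_|[|i] lin] /=; first by ring.
    by rewrite lE // L0; ring.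
  by rewrite lE 1?ltnW //; ring.
rewrite -(convol_coefM fE fE).
(* By [L_recl], the inner difference has coefficient $-1$ in each positive degree below the
   truncation; this produces the $-4$ of [discr]. *)
have -> : f * f = (1 - 'X) ^+ 2 + 4 *: ('X * ('X * (l * l + l) - l)).
  by rewrite /f -!mul_polyC; ring.
rewrite coefD coefZ coefXM.
have -> : ((1 - 'X) ^+ 2)`_n = (n == 0%N)%:R - 2 * (n == 1%N)%:R + (n == 2%N)%:R :> R.
  have -> : (1 - 'X) ^+ 2 = 1 - 2 *: 'X + 'X^2 :> {poly R}.
    by rewrite -mul_polyC; ring.
  by rewrite coefD coefB coef1 coefZ coefX coefXn.
case: n l lE @f fE => [|n] l lE f fE /=; first by ring.
rewrite coefB coefXM lE //.
case: n l lE @f fE => [|n] l lE f fE; rewrite /= ?L0; first by ring.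
have lle i : (i <= n)%N -> l`_i = (L i)%:R by move=> ?; apply: lE; lia.
rewrite coefD lle // (convol_coefM lle lle) L_recl !natrD natr_sum /convol.
have -> : \sum_(i < n.+1) (L i * L (n - i))%:R =
    \sum_(i < n.+1) (L i)%:R * (L (n - i))%:R :> R.
  by apply: eq_bigr => i _; rewrite natrM.
by clear; case: n => [|n] /=; ring.
Qed.

Variable rho : R.
Hypothesis rho_neq0 : rho != 0.
Hypothesis rho_root : rho ^+ 3 + rho ^+ 2 + 3 * rho = 1.

(* Coefficients of the cofactor W in discr = (1 - z / rho) W. *)
Definition cofactor_discr (n : nat) : R :=
  match n with 0 => 1 | 1 => rho^-1 - 2 | _ => rho^-1 - 2 + rho end.

Lemma convol_cofactor_discr : convol (one_sub rho^-1) cofactor_discr = discr.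
Proof.
apply/funext => -[|n]; first by rewrite convol0 mulr1.
rewrite convol_one_subS.
case: n => [|n] /=; first by field.
(* From degree 2 on, the two sides differ by one and the same multiple of the equation of [rho]. *)
apply/subr0_eq; transitivity ((rho ^+ 3 + rho ^+ 2 + 3 * rho - 1) / rho ^+ 2).
  by case: n => [|n]; field.
by rewrite rho_root subrr mul0r.
Qed.

(** The quotient $B=F/(1-z/\rho)^{1/2}$, written as $F\,(1-z/\rho)^{1/2}\,(1-z/\rho)^{-1}$ to use
    only series already built. *)
Definition root_cofactor : nat -> R :=
  convol (convol root_discr (sqrt_one_sub rho^-1)) (geom rho^-1).

Lemma convol_root_cofactor : convol root_cofactor root_cofactor = cofactor_discr.
Proof.
pose c := rho^-1.
have sqrM (u v : nat -> R) : convol (convol u v) (convol u v) = convol (convol u u) (convol v v).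
  exact: Monoid.mulmACA.
rewrite /root_cofactor 2!sqrM convol_root_discr convol_sqrt_one_sub.
rewrite -convol_cofactor_discr -/c [convol _ cofactor_discr]convolC -!convolA.
by rewrite (convolA (one_sub c) (geom c)) convol_one_sub_geom Monoid.mul1m
  convol_one_sub_geom Monoid.mulm1.
Qed.

Lemma convol_sqrt_root_cofactor :
  convol (sqrt_one_sub rho^-1) root_cofactor = root_discr.
Proof.
rewrite /root_cofactor convolA [convol root_discr _]convolC convolA convol_sqrt_one_sub.
by rewrite convolC convolA [convol (geom _) _]convolC convol_one_sub_geom Monoid.mul1m.
Qed.

End Discriminant.

(** * Euler's integral at half-integers *)

Section GammaIntegral.
Context {R : realType}.
Notation mu := (@lebesgue_measure R).
Implicit Types (s t : R).

Definition gamma_fun s t : R := t `^ (s - 1) * expR (- t).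

Definition gamma_int s : \bar R :=
  (\int[mu]_(t in `]0%R, +oo[) (gamma_fun s t)%:E)%E.

Lemma gamma_fun_ge0 s t : 0 <= gamma_fun s t.
Proof. by rewrite mulr_ge0 ?powR_ge0 ?expR_ge0. Qed.

Lemma measurable_gamma_fun s (D : set R) : measurable_fun D (gamma_fun s).
Proof.
apply: measurable_funTS; apply: measurable_funM; first exact: measurable_powR.
by apply: measurableT_comp => //; exact: measurable_expR.
Qed.

Lemma gamma_int_ge0 s : (0 <= gamma_int s)%E.
Proof. by apply: integral_ge0 => t _; rewrite lee_fin gamma_fun_ge0. Qed.

(** Monotone convergence along compact intervals away from 0, where integration by parts applies.
    The shift by 2 keeps the endpoints distinct. *)
Lemma cvg_gamma_int s :
  (\int[mu]_(t in `[n.+2%:R^-1%R, n.+2%:R%R]) (gamma_fun s t)%:E)%E @[n --> \oo]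
    --> gamma_int s.
Proof.
rewrite /gamma_int.
have -> : `]0, +oo[%classic = \bigcup_n `[(n.+2%:R : R)^-1, n.+2%:R]%classic.
  apply/seteqP; split => t /=; rewrite in_itv /= ?andbT.
    move=> t0; pose n := (Num.truncn t + Num.truncn t^-1)%N.
    exists n => //=; rewrite in_itv /=.
    have tn : t <= n.+2%:R.
      by apply: (le_trans (ltW (truncnS_gt t))); rewrite ler_nat ltnS leqW ?leq_addr.
    rewrite tn andbT invf_ple ?posrE //.
    by apply: (le_trans (ltW (truncnS_gt t^-1))); rewrite ler_nat ltnS leqW ?leq_addl.
  move=> [n _] /=; rewrite in_itv /= => /andP[+ _].
  by apply: lt_le_trans; rewrite invr_gt0.
apply: ge0_nondecreasing_set_cvg_integral.
- apply/nondecreasing_seqP => n; rewrite subsetEset => t /=.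
  rewrite !in_itv /= => /andP[nt tn]; apply/andP; split.
    by apply: le_trans nt; rewrite lef_pV2 ?posrE // ler_nat.
  by apply: (le_trans tn); rewrite ler_nat.
- by move=> n; exact: measurable_itv.
- by move=> n; apply/measurable_EFinP; exact: measurable_gamma_fun.
- by move=> n t _; rewrite lee_fin gamma_fun_ge0.
Qed.

(** For $t=n+2$ and $m$ the truncation of $s$, $t^s \le t^{m+1}$ while $e^t \ge t^{m+2}/(m+2)!$,
    which leaves $O(1/t)$. *)
Lemma powR_expRN_cvg0 s : n.+2%:R `^ s * expR (- n.+2%:R) @[n --> \oo] --> (0 : R).
Proof.
pose m := Num.truncn s.
pose K := m.+2`!%:R : R.
apply: (@squeeze_cvgr _ _ _ _ (fun=> 0) (fun n => K * n.+1%:R^-1)).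
- apply: nearW => n; rewrite mulr_ge0 ?powR_ge0 ?expR_ge0 //=.
  have n2 : (0 : R) < n.+2%:R by [].
  have h1 : n.+2%:R `^ s <= n.+2%:R ^+ m.+1 :> R.
    rewrite -powR_mulrn ?ler0n //; apply: ler_powR; first by rewrite ler1n.
    exact/ltW/truncnS_gt.
  have h2 : n.+2%:R ^+ m.+2 / K <= expR n.+2%:R :> R.
    by apply: le_trans (expR_ge1Dxn m.+1 (ltW n2)); rewrite lerDr.
  have K0 : 0 < K by rewrite ltr0n fact_gt0.
  rewrite expRN ler_pdivrMr ?expR_gt0 //.
  apply: (le_trans h1).
  apply: le_trans (_ : K / n.+2%:R * (n.+2%:R ^+ m.+2 / K) <= _).
    rewrite [X in _ <= _ * (X / _)]exprS le_eqVlt; apply/orP; left; apply/eqP.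
    by field; rewrite !gt_eqF.
  apply: ler_pM => //.
  - by rewrite divr_ge0 // ltW.
  - by rewrite divr_ge0 ?exprn_ge0 // ltW.
  - by rewrite ler_pM2l // lef_pV2 ?posrE // ler_nat.
- exact: cvg_cst.
- rewrite -[X in _ --> X](mulr0 K); apply: cvgM; first exact: cvg_cst.
  exact: cvg_harmonic.
Qed.

(** Integration by parts with vanishing boundary terms [d n]. Stated in the extended reals, it also
    transfers finiteness from one argument to the other. *)
Lemma gamma_intS s : 0 < s -> (gamma_int (s + 1) = s%:E * gamma_int s)%E.
Proof.
move=> s0.
pose a n := (n.+2%:R : R)^-1; pose b n := n.+2%:R : R.
pose d n := a n `^ s * expR (- a n) - b n `^ s * expR (- b n).
have d0 : d n @[n --> \oo] --> (0 : R).
  rewrite -[X in _ --> X](subr0 0); apply: cvgB; last exact: powR_expRN_cvg0.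
  have a0 : a n @[n --> \oo] --> (0 : R).
    have := @cvg_harmonic R; rewrite -(cvg_shiftS (@harmonic R : nat -> R^o)); exact.
  apply: (@squeeze_cvgr _ _ _ _ (fun=> 0) (fun n => a n `^ s)).
  - apply: nearW => n; rewrite mulr_ge0 ?powR_ge0 ?expR_ge0 //=.
    by rewrite ler_piMr ?powR_ge0 // expR_le1 oppr_le0 invr_ge0.
  - exact: cvg_cst.
  - apply: (cvg_comp a _ _ (powR_cvg0 s0)).
    move=> A /= [e e0 eA].
    have /cvgrPdist_lt/(_ e e0) := a0; apply: filterS => n an.
    by apply: eA => //=; rewrite /a invr_gt0.
have parts n : (\int[mu]_(t in `[a n, b n]) (gamma_fun (s + 1) t)%:E =
    (d n)%:E + s%:E * \int[mu]_(t in `[a n, b n]) (gamma_fun s t)%:E)%E.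
  have an0 : 0 < a n by rewrite invr_gt0.
  have ab : a n < b n.
    by apply: (@lt_le_trans _ _ 1); rewrite ?invf_lt1 ?ltr1n // ler1n.
  have pos t : a n <= t -> 0 < t by apply: lt_le_trans.
  have cpow r t : 0 < t -> {for t, continuous (fun u : R => u `^ r)}.
    move=> t0; apply/differentiable_continuous/derivable1_diffP.
    by apply: derivable_powR; rewrite in_itv /= andbT.
  have cexp : continuous (fun t => - expR (- t) : R).
    move=> t; apply: cvgN; apply: continuous_comp; first exact: opp_continuous.
    exact: continuous_expR.
  have dexp (t : R) : is_derive t 1 (fun u => - expR (- u) : R) (expR (- t)).
    by apply: is_derive_eq; rewrite mulrN1 opprK.
  have cexpN : continuous (fun t => expR (- t) : R).
    move=> t; apply: continuous_comp; first exact: opp_continuous.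
    exact: continuous_expR.
  transitivity (\int[mu]_(t in `[a n, b n]) (t `^ s * expR (- t))%:E)%E.
    by apply: eq_integral => t _; rewrite /gamma_fun addrK.
  rewrite (@integration_by_parts R (fun t => t `^ s) (fun t => - expR (- t))
    (fun t => s * t `^ (s - 1)) (fun t => expR (- t)) _ _ ab).
  - rewrite -ge0_integralZl //=; first last.
    + exact: ltW.
    + by move=> t _; rewrite lee_fin gamma_fun_ge0.
    + by apply/measurable_EFinP; exact: measurable_gamma_fun.
    have -> : (\int[mu]_(t in `[a n, b n]) (s * t `^ (s - 1) * - expR (- t))%:E =
        \int[mu]_(t in `[a n, b n]) (- (s%:E * (gamma_fun s t)%:E)))%E.
      by apply: eq_integral => t _; rewrite -EFinM -EFinN /gamma_fun; congr _%:E; ring.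
    rewrite integral_ge0N => [|t _]; last first.
      by rewrite -EFinM lee_fin mulr_ge0 ?gamma_fun_ge0 // ltW.
    by rewrite oppeK; congr (_ + _)%E; congr _%:E; rewrite /d; ring.
  - apply: continuous_in_subspaceT => t.
    rewrite inE /= in_itv /= => /andP[/pos t0 _].
    by apply: cvgM; [exact: cvg_cst|exact: cpow].
  - split.
    + move=> t; rewrite in_itv /= => /andP[/ltW/pos t0 _].
      by apply: derivable_powR; rewrite in_itv /= andbT.
    + exact/cvg_at_right_filter/cpow.
    + exact/cvg_at_left_filter/cpow/(lt_trans an0 ab).
  - move=> t; rewrite in_itv /= => /andP[/ltW/pos t0 _].
    by apply: powR_derive1; rewrite in_itv /= andbT.
  - exact: continuous_subspaceT.
  - split => [t _||].
    + by apply: ex_derive; exact: dexp.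
    + exact/cvg_at_right_filter/cexp.
    + exact/cvg_at_left_filter/cexp.
  - by move=> t _; rewrite derive1E; apply: derive_val.
have /cvg_lim <- // := @cvg_gamma_int (s + 1).
apply/cvg_lim => //; rewrite (funext parts).
rewrite -[X in _ --> X]add0e; apply: cvgeD.
- by rewrite fin_num_adde_defr.
- by apply: cvg_EFin => //; exact: nearW.
- by apply: cvgeZl => //; exact: cvg_gamma_int.
Qed.

Lemma gamma_int1 : gamma_int 1 = 1%:E.
Proof.
rewrite /gamma_int integral_itv_obnd_cbnd; last first.
  by apply/measurable_EFinP; exact: measurable_gamma_fun.
transitivity (\int[mu]_(t in `[0%R, +oo[) (expR (- t))%:E)%E.
  by apply: eq_integral => t _; rewrite /gamma_fun subrr powRr0 mul1r.
have cexpN : continuous (fun t => expR (- t) : R).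
  move=> t; apply: continuous_comp; first exact: opp_continuous.
  exact: continuous_expR.
have dexp (t : R) : is_derive t 1 (fun u => - expR (- u) : R) (expR (- t)).
  by apply: is_derive_eq; rewrite mulrN1 opprK.
rewrite (@ge0_continuous_FTC2y R (fun t => expR (- t)) (fun t => - expR (- t)) _ 0) //.
- by rewrite oppr0 expR0 -EFinB sub0r opprK.
- exact: continuous_subspaceT.
- by rewrite -[X in _ --> X]oppr0; apply: cvgN; exact: cvgr_expR.
- by apply: cvg_at_right_filter; apply: cvgN; exact: cexpN.
- by move=> t _; rewrite derive1E; apply: derive_val.
Qed.

(** Integers follow by induction from 1. At $m+3/2$ the integrand is at most the sum of those at
    $m+1$ and $m+2$, and the functional equation descends to $m+1/2$. *)
Lemma gamma_int_half_lty (k : nat) : (gamma_int (k.+1%:R / 2) < +oo)%E.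
Proof.
have nat_lty (m : nat) : (gamma_int m.+1%:R < +oo)%E.
  elim: m => [|m IHm]; first by rewrite gamma_int1 ltry.
  by rewrite -natr1 gamma_intS // lte_mul_pinfty // lee_fin.
have half_lty (m : nat) : (gamma_int (m%:R + 2^-1) < +oo)%E.
  have : (gamma_int (m%:R + 2^-1 + 1) < +oo)%E.
    have le_g : (gamma_int (m%:R + 2^-1 + 1) <=
        gamma_int m.+1%:R + gamma_int m.+2%:R)%E.
      have g0 u t : (0 <= (gamma_fun u t)%:E)%E by rewrite lee_fin gamma_fun_ge0.
      rewrite /gamma_int -ge0_integralD //;
        try by apply/measurable_EFinP; exact: measurable_gamma_fun.
      apply: ge0_le_integral => //;
        try by apply/measurable_EFinP; exact: measurable_gamma_fun.
        by apply: emeasurable_funD; apply/measurable_EFinP; exact: measurable_gamma_fun.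
      move=> t /=; rewrite in_itv /= andbT => t0.
      rewrite -EFinD lee_fin /gamma_fun -mulrDl ler_wpM2r ?expR_ge0 //.
      rewrite -[m.+2%:R]natr1 -[m.+1%:R]natr1 !addrK.
      have [t1|/ltW t1] := leP 1 t.
        apply: (@le_trans _ _ (t `^ (m%:R + 1))); last by rewrite lerDr powR_ge0.
        by apply: ler_powR => //; lra.
      apply: (@le_trans _ _ (t `^ m%:R)); last by rewrite lerDl powR_ge0.
      by apply: ger_powR; [rewrite t0|lra].
    by apply: (le_lt_trans le_g); rewrite lte_add_pinfty.
  have m0 : 0 < m%:R + 2^-1 :> R by rewrite ltr_wpDl // ler0n.
  rewrite gamma_intS //; case: gamma_int (gamma_int_ge0 (m%:R + 2^-1)) => [r||] // _.
    by move=> _; exact: ltry.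
  by rewrite gt0_muley ?lte_fin.
move: (k./2) (odd_double_half k) => h <-; case: odd; rewrite ?add1n ?add0n.
  by rewrite -doubleS -muln2 natrM mulfK ?pnatr_eq0 //; exact: nat_lty.
rewrite -natr1 mulrDl -muln2 natrM mulfK ?pnatr_eq0 // mul1r.
exact: half_lty.
Qed.

Lemma integrable_gamma_fun_half (k : nat) :
  mu.-integrable `]0%R, +oo[ (EFin \o gamma_fun (k.+1%:R / 2)).
Proof.
apply/integrableP; split.
  by apply/measurable_EFinP; exact: measurable_gamma_fun.
apply: le_lt_trans (gamma_int_half_lty k).
rewrite le_eqVlt; apply/orP; left; apply/eqP.
by apply: eq_integral => t _ /=; rewrite ger0_norm ?gamma_fun_ge0.
Qed.

(** The value $\Gamma((k+1)/2)$; the shift keeps the argument positive at $k=0$. *)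
Definition gamma_half (k : nat) : R :=
  \int[mu]_(t in `]0%R, +oo[) gamma_fun (k.+1%:R / 2) t.

Lemma gamma_half1 : gamma_half 1 = 1.
Proof. by rewrite /gamma_half /Rintegral divff ?pnatr_eq0 // -/(gamma_int 1) gamma_int1. Qed.

Lemma gamma_halfSS (k : nat) : gamma_half k.+2 = k.+1%:R / 2 * gamma_half k.
Proof.
rewrite /gamma_half /Rintegral -!/(gamma_int _).
have -> : k.+3%:R / 2 = k.+1%:R / 2 + 1 :> R by rewrite -[k.+3%:R]natr1 -[k.+2%:R]natr1; field.
rewrite gamma_intS ?divr_gt0 // fineM // fin_numElt (gamma_int_half_lty k).
by rewrite (lt_le_trans _ (gamma_int_ge0 _)).
Qed.

Lemma gamma_half_ge0 (k : nat) : 0 <= gamma_half k.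
Proof. by apply: Rintegral_ge0 => t _; exact: gamma_fun_ge0. Qed.

(* Integrating (l - sqrt t)^2 t^(s-1) e^(-t) >= 0. *)
Lemma gamma_half_quadratic (k : nat) (l : R) :
  0 <= l ^+ 2 * gamma_half k - 2 * l * gamma_half k.+1 + gamma_half k.+2.
Proof.
have iZ c j : mu.-integrable `]0%R, +oo[ (EFin \o (fun t => c * gamma_fun (j.+1%:R / 2) t)).
  by have ig := integrableZl _ c (integrable_gamma_fun_half j); exact: ig.
have -> : l ^+ 2 * gamma_half k - 2 * l * gamma_half k.+1 + gamma_half k.+2 =
    \int[mu]_(t in `]0%R, +oo[) (l ^+ 2 * gamma_fun (k.+1%:R / 2) t -
      2 * l * gamma_fun (k.+2%:R / 2) t + gamma_fun (k.+3%:R / 2) t).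
  rewrite RintegralD //; first last.
  - exact: integrable_gamma_fun_half.
  - by have iB := integrableB _ (iZ (l ^+ 2) k) (iZ (2 * l) k.+1); exact: iB.
  rewrite RintegralB // ?RintegralZl //; exact: integrable_gamma_fun_half.
apply: Rintegral_ge0 => t; rewrite /= in_itv /= andbT => t0.
rewrite /gamma_fun.
set s := k.+1%:R / 2.
have -> : k.+2%:R / 2 - 1 = (s - 1) + 2^-1 by rewrite /s -[k.+2%:R]natr1; field.
have -> : k.+3%:R / 2 - 1 = (s - 1) + 2^-1 + 2^-1.
  by rewrite /s -[k.+3%:R]natr1 -[k.+2%:R]natr1; field.
have tD r q : t `^ (r + q) = t `^ r * t `^ q.
  by rewrite powRD // (gt_eqF t0) implybT.
rewrite !tD; set u := t `^ 2^-1.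
have -> : l ^+ 2 * (t `^ s * t `^ (- 1) * expR (- t)) -
    2 * l * (t `^ s * t `^ (- 1) * u * expR (- t)) +
    t `^ s * t `^ (- 1) * u * u * expR (- t) =
    (l - u) ^+ 2 * (t `^ s * t `^ (- 1)) * expR (- t) by ring.
apply: mulr_ge0; last exact: expR_ge0.
by apply: mulr_ge0; [exact: sqr_ge0|apply: mulr_ge0; exact: powR_ge0].
Qed.

(** Cauchy-Schwarz: the quadratic in [l] is evaluated at its minimiser $b/a$. *)
Lemma gamma_half_logconvex (k : nat) :
  gamma_half k.+1 ^+ 2 <= gamma_half k * gamma_half k.+2.
Proof.
have q := gamma_half_quadratic k.
move: (gamma_half_ge0 k) q; set a := gamma_half k; set b := gamma_half k.+1.
set c := gamma_half k.+2; rewrite le_eqVlt => /predU1P[<-|a0] q.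
  have [->|b0] := eqVneq b 0; first by rewrite expr0n mul0r.
  (* For $a=0$ the quadratic is affine in [l], and this choice gives it the value $-1$. *)
  have := q ((c + 1) / (2 * b)); rewrite mulr0 sub0r.
  have -> : 2 * ((c + 1) / (2 * b)) * b = c + 1 by field.
  by lra.
have := q (b / a).
have -> : (b / a) ^+ 2 * a - 2 * (b / a) * b + c = (a * c - b ^+ 2) / a.
  by field; rewrite gt_eqF.
by rewrite pmulr_lge0 ?invr_gt0 // subr_ge0.
Qed.

(** If $\Gamma(1/2)$ were 0, log-convexity would force $\Gamma(1)^2 \le 0$; the functional equation
    does the rest. *)
Lemma gamma_half_gt0 (k : nat) : 0 < gamma_half k.
Proof.
have g0 : 0 < gamma_half 0.
  rewrite lt_def gamma_half_ge0 andbT; apply/eqP => g0.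
  by have := gamma_half_logconvex 0; rewrite g0 mul0r gamma_half1 expr1n ler10.
suff : 0 < gamma_half k /\ 0 < gamma_half k.+1 by case.
elim: k => [|k [g1 g2]]; first by rewrite gamma_half1.
by rewrite gamma_halfSS mulr_gt0 // divr_gt0.
Qed.

(** The truncation of $3/2$ is 1, so [Gamma] takes a single step: a division by $-1/2$. *)
Lemma Gamma_neg_half : Gamma (- (1 / 2)) = - 2 * gamma_half 0 :> R.
Proof.
rewrite /Gamma.
have -> : Num.truncn (1 - - (1 / 2) : R) = 1%N.
  by apply/eqP; rewrite truncn_eq; lra.
rewrite big_ord1 addr0.
have -> : - (1 / 2) + 1%:R - 1 = 1%:R / 2 - 1 :> R by lra.
by rewrite /gamma_half /gamma_fun; field.
Qed.

End GammaIntegral.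

(** * Cauchy products and the coefficients of the square root *)

Section Series.
Context {R : realType}.
Implicit Types (u v g l : nat -> R).

Lemma convol_geom1 u n : convol u (geom 1) n = \sum_(k < n.+1) u k.
Proof. by apply: eq_bigr => i _; rewrite /geom expr1n mulr1. Qed.

(** Taking partial sums is convolution with [geom 1], so this is associativity. *)
Lemma sum_convol u v n :
  \sum_(k < n.+1) convol u v k = \sum_(i < n.+1) u i * \sum_(j < (n - i).+1) v j.
Proof.
rewrite -convol_geom1 -convolA; apply: eq_bigr => i _.
by rewrite convol_geom1.
Qed.

(** Dominated convergence for sums of growing length: cut at an [M] beyond which the tails of [g]
    and [l] are at most $e/3$, and pass to the limit in the finite head. *)
Lemma tannery (f : nat -> nat -> R) g l :
  (forall n k, (k <= n)%N -> `|f n k| <= g k) -> cvgn (series g) ->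
  (forall k, f n k @[n --> \oo] --> l k) ->
  cvgn (series l) /\ \sum_(k < n.+1) f n k @[n --> \oo] --> limn (series l).
Proof.
move=> fg cg fl.
have g0 k : 0 <= g k by apply: le_trans (fg k k _).
have lg k : `|l k| <= g k.
  apply: (cvgr_to_le (cvg_norm (fl k))).
  by exists k => // n /= kn; exact: fg.
have cl : cvgn (series l).
  by apply: normed_cvg; apply: (series_le_cvg _ g0 lg cg).
have gnd : {homo series g : n m / (n <= m)%N >-> n <= m}.
  move=> n m nm; rewrite -subr_ge0 sub_series_geq //.
  by apply: sumr_ge0 => k _.
split => //; apply/cvgrPdist_le => e e0.
have e3 : 0 < e / 3 by rewrite divr_gt0.
have /cvgrPdist_le/(_ _ e3)[M1 _ hM1] := cg.
have /cvgrPdist_le/(_ _ e3)[M2 _ hM2] := cl.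
have [M [M1M M2M]] : exists M, (M1 <= M)%N /\ (M2 <= M)%N.
  by exists (maxn M1 M2); rewrite leq_maxl leq_maxr.
have hg : limn (series g) - series g M <= e / 3.
  by apply: le_trans (ler_norm _) _; exact: hM1.
have hl : `|limn (series l) - series l M| <= e / 3 by exact: hM2.
have /cvgrPdist_le/(_ _ e3)[N _ hN] :
    \sum_(0 <= k < M) f n k @[n --> \oo] --> series l M.
  elim: M {M1M M2M hg hl} => [|m IHm].
    rewrite seriesEnat /= big_geq //; under eq_fun do rewrite big_geq //.
    exact: cvg_cst.
  rewrite seriesSr; under eq_fun do rewrite big_nat_recr //=.
  exact: cvgD.
exists (maxn M N) => // n /=; rewrite geq_max => /andP[Mn Nn].
rewrite -(big_mkord xpredT) /= (@big_cat_nat _ _ _ M) //=; last exact: leqW.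
have tail : `|\sum_(M <= k < n.+1) f n k| <= e / 3.
  apply: (le_trans (ler_norm_sum _ _ _)).
  apply: (@le_trans _ _ (\sum_(M <= k < n.+1) g k)).
    by apply: ler_sum_nat => k /andP[_ kn]; exact: fg.
  rewrite -sub_series_geq; last exact: leqW.
  apply: le_trans hg; rewrite lerD2r.
  exact: nondecreasing_cvgn_le.
have := hN n Nn.
move: hl tail; rewrite !ler_norml => /andP[? ?] /andP[? ?] /andP[? ?].
by apply/andP; split; lra.
Qed.

(* Mertens' theorem for an absolutely convergent square, by Tannery with
   f n i = u i * (u 0 + ... + u (n - i)). *)
Lemma cvg_sum_convol u : cvgn (series (fun k => `|u k|)) ->
  \sum_(k < n.+1) convol u u k @[n --> \oo] --> limn (series u) ^+ 2.
Proof.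
move=> cu; have cu' : cvgn (series u) by exact: normed_cvg.
pose G := limn (series (fun k => `|u k|)).
have hG n : series (fun k => `|u k|) n <= G.
  apply: nondecreasing_cvgn_le => // i j ij.
  by rewrite -subr_ge0 sub_series_geq // sumr_ge0.
have cuS : series u n.+1 @[n --> \oo] --> limn (series u).
  by have := cu'; rewrite -[X in X -> _](cvg_shiftS (series u)).
have partial n : \sum_(k < n.+1) u k = series u n.+1 by rewrite seriesEord.
have [|||_] := @tannery (fun n i => u i * \sum_(j < (n - i).+1) u j)
    (fun i => G * `|u i|) (fun i => limn (series u) * u i).
- move=> n i _; rewrite normrM mulrC ler_wpM2r //.
  apply: (le_trans (ler_norm_sum _ _ _)).
  by have := hG (n - i).+1; rewrite seriesEord.
- exact: is_cvg_seriesZ.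
- move=> i; rewrite mulrC; apply: cvgM; first exact: cvg_cst.
  rewrite (_ : (fun n => _) = fun n => series u (n - i).+1); last first.
    by apply/funext => n; rewrite partial.
  rewrite -(cvg_shiftn i).
  under eq_fun do rewrite addnK.
  exact: cuS.
have -> : limn (series (fun i => limn (series u) * u i)) = limn (series u) ^+ 2.
  by rewrite (lim_seriesZ (limn (series u)) cu') expr2.
by under [X in _ -> X @ _ --> _]eq_fun do rewrite sum_convol.
Qed.

End Series.

(** * Asymptotics of the coefficients of $(1-z)^{1/2}$ *)

Section SqrtCoefAsymptotics.
Context {R : realType}.
Let g := @gamma_half R.
Let s : nat -> R := sqrt_coef.

Lemma fact_gamma_half (n : nat) : n`!%:R = g (n.*2.+1).
Proof.
elim: n => [|n IHn]; first by rewrite /g gamma_half1.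
rewrite factS natrM IHn doubleS /g gamma_halfSS; congr (_ * _).
have -> : n.*2.+2 = (n.+1 * 2)%N by rewrite muln2.
by rewrite natrM mulfK ?pnatr_eq0.
Qed.

(** Passing from $n$ to $n+1$ multiplies both sides by $(n+1/2)/(n+2)$. *)
Lemma sqrt_coef_gamma_half (n : nat) :
  s n.+1 = - g n.*2 / (2 * g 0 * n.+1`!%:R).
Proof.
have g0 : g 0 != 0 by rewrite gt_eqF // /g gamma_half_gt0.
have f0 : n.+1`!%:R != 0 :> R by rewrite pnatr_eq0 -lt0n fact_gt0.
elim: n f0 => [|n IHn] f0; first by rewrite /s /= (_ : 1`! = 1%N) //; field.
have f1 : n.+1`!%:R != 0 :> R by rewrite pnatr_eq0 -lt0n fact_gt0.
have -> : s n.+2 = s n.+1 * ((n.+1%:R - 2^-1) / n.+2%:R) by [].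
rewrite (IHn f1) doubleS /g gamma_halfSS [n.+2`!]factS natrM.
have -> : n.*2.+1%:R = n.+1%:R * 2 - 1 :> R.
  by rewrite -natrM muln2 doubleS -[n.*2.+2%:R]natr1 addrK.
by field; rewrite f1 -natrD pnatr_eq0 g0.
Qed.

(** This is $(n+1)^{3/2}$, shifted so as never to vanish. *)
Definition weight (n : nat) : R := n.+1%:R * Num.sqrt n.+1%:R.

Lemma weight_gt0 (n : nat) : 0 < weight n.
Proof. by rewrite mulr_gt0 // sqrtr_gt0. Qed.

(* By log-convexity, 1 <= e n ^ 2 <= 1 + 1 / n for
   e n = Gamma(n + 1/2) sqrt(n + 1) / Gamma(n + 1). *)
Lemma cvg_sqrt_coef :
  s n.+1 * weight n @[n --> \oo] --> - (2 * g 0)^-1.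
Proof.
have gt0 k : 0 < g k by exact: gamma_half_gt0.
pose e n := g n.*2 / g n.*2.+1 * Num.sqrt n.+1%:R.
have e0 n : 0 <= e n by rewrite mulr_ge0 ?sqrtr_ge0 // divr_ge0 // ltW.
have e2 n : e n ^+ 2 = g n.*2 ^+ 2 * n.+1%:R / g n.*2.+1 ^+ 2.
  by rewrite exprMn sqr_sqrtr ?ler0n // exprMn exprVn mulrAC.
(* Log-convexity at [n.*2], with $\Gamma(n+3/2)=(n+1/2)\Gamma(n+1/2)$ and $n+1/2 \le n+1$. *)
have e_ge1 n : 1 <= e n.
  rewrite -(@expr_ge1 _ 2) // e2 ler_pdivlMr ?exprn_gt0 // mul1r.
  apply: (le_trans (gamma_half_logconvex _)); rewrite -/g /g gamma_halfSS -/g.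
  rewrite mulrCA -expr2 mulrC ler_wpM2l ?sqr_ge0 // ler_pdivrMr // -natrM ler_nat.
  by rewrite muln2 doubleS ltnW.
(* As $e \ge 1$, it suffices to bound the square, by log-convexity at [n.*2.+1]. *)
have e_le n : e n.+1 <= 1 + n.+1%:R^-1.
  apply: (@le_trans _ _ (e n.+1 ^+ 2)); first by rewrite ler_eXnr.
  rewrite e2 ler_pdivrMr ?exprn_gt0 //.
  have gS : g n.+1.*2.+1 = n.+1%:R * g n.*2.+1.
    rewrite /g gamma_halfSS; congr (_ * _).
    have -> : n.*2.+2 = (n.+1 * 2)%N by rewrite muln2.
    by rewrite natrM mulfK ?pnatr_eq0.
  rewrite gS; have -> : (1 + n.+1%:R^-1) * (n.+1%:R * g n.*2.+1) ^+ 2 =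
      g n.*2.+1 * (n.+1%:R * g n.*2.+1) * n.+2%:R.
    by rewrite -[n.+2%:R]natr1; field; rewrite nat1r pnatr_eq0.
  rewrite ler_wpM2r ?ler0n //.
  by rewrite -gS; exact: gamma_half_logconvex n.*2.+1.
have ecvg : e n @[n --> \oo] --> (1 : R).
  rewrite -(cvg_shiftS e).
  apply: (@squeeze_cvgr _ _ _ _ (fun=> 1) (fun n => 1 + n.+1%:R^-1)).
  - by apply: nearW => n; rewrite e_ge1 e_le.
  - exact: cvg_cst.
  - rewrite -[X in _ --> X]addr0; apply: cvgD; first exact: cvg_cst.
    exact: cvg_harmonic.
rewrite (_ : (fun n => _) = fun n => - (2 * g 0)^-1 * e n); last first.
  apply/funext => n; rewrite sqrt_coef_gamma_half /weight /e factS natrM fact_gamma_half.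
  by field; rewrite !gt_eqF //= nat1r.
rewrite -[X in _ --> X]mulr1; apply: cvgM => //; exact: cvg_cst.
Qed.

Lemma cvg_weight_ratio (k : nat) :
  weight (n + k)%N / weight n @[n --> \oo] --> (1 : R).
Proof.
pose t n : R := (n + k)%N.+1%:R / n.+1%:R.
have tcvg : t n @[n --> \oo] --> (1 : R).
  rewrite (_ : t = fun n => 1 + k%:R * n.+1%:R^-1); last first.
    apply/funext => n; rewrite /t -addSn natrD; field; by rewrite nat1r pnatr_eq0.
  rewrite -[X in _ --> X]addr0; apply: cvgD; first exact: cvg_cst.
  rewrite -(mulr0 k%:R); apply: cvgM; [exact: cvg_cst|exact: cvg_harmonic].
rewrite (_ : (fun n => _) = fun n => t n * Num.sqrt (t n)); last first.
  apply/funext => n; rewrite /weight /t sqrtrM ?ler0n // sqrtrV ?ler0n //.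
  by field; rewrite nat1r pnatr_eq0 /= gt_eqF // sqrtr_gt0.
rewrite -[X in _ --> X]mulr1; apply: cvgM => //.
rewrite -[X in _ --> X]sqrtr1; apply: cvg_comp tcvg _; exact: sqrt_continuous.
Qed.

End SqrtCoefAsymptotics.

(** * The cofactor of the square-root singularity *)

Section Cofactor.
Context {R : realType}.

Lemma convol_selfS (u : nat -> R) (n : nat) :
  convol u u n.+1 = 2 * u 0%N * u n.+1 + \sum_(i < n) u i.+1 * u (n - i)%N.
Proof.
rewrite /convol big_ord_recl big_ord_recr /= subn0 subnn.
rewrite (_ : \sum_(i < n) _ = \sum_(i < n) u i.+1 * u (n - i)%N); first by ring.
by apply: eq_bigr => i _; rewrite subSS.
Qed.

(* Square root of a power series: if B^2 = W, then y = B - 1 satisfies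
   2 y = (W - 1) - y^2, and the majorant series stays below 1. *)
Lemma sqrt_series_bound (B W : nat -> R) (r : R) :
  0 <= r -> B 0%N = 1 -> convol B B = W ->
  (forall n, \sum_(k < n) `|W k.+1| * r ^+ k.+1 <= 1) ->
  forall n, \sum_(k < n) `|B k.+1| * r ^+ k.+1 <= 1.
Proof.
move=> r0 B0 BW Wle.
pose y n : R := if n is m.+1 then `|B m.+1| * r ^+ m.+1 else 0.
have y0 n : 0 <= y n by case: n => //= n; rewrite mulr_ge0 ?exprn_ge0.
pose Y n : R := \sum_(k < n.+1) y k.
have YE n : Y n = \sum_(k < n) `|B k.+1| * r ^+ k.+1.
  by rewrite /Y big_ord_recl add0r.
have step n : 2 * y n.+1 <= `|W n.+1| * r ^+ n.+1 + convol y y n.+1.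
  have := congr1 (fun f => f n.+1) BW; rewrite /= !convol_selfS B0 !mulr1 mulr0 mul0r add0r.
  set S := \sum_(i < n) B _ * _ => h.
  have -> : 2 * y n.+1 = `|W n.+1 - S| * r ^+ n.+1.
    by rewrite -h addrK normrM mulrA ger0_norm.
  apply: (@le_trans _ _ ((`|W n.+1| + `|S|) * r ^+ n.+1)).
    by rewrite ler_wpM2r ?exprn_ge0 // ler_normB.
  rewrite mulrDl lerD2l.
  apply: le_trans (ler_wpM2r (exprn_ge0 _ r0) (ler_norm_sum _ _ _)) _.
  rewrite mulr_suml; apply: ler_sum => i _.
  have [m nE] : exists m, (n - i = m.+1)%N.
    by exists (n - i).-1; rewrite prednK // subn_gt0.
  rewrite nE /= normrM mulrACA -exprD.
  by rewrite (_ : (i.+1 + m.+1 = n.+1)%N) //; have := ltn_ord i; lia.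
suff Yle n : Y n <= 1 by move=> n; rewrite -YE.
elim/ltn_ind: n => -[|n] IHn; first by rewrite YE big_ord0.
have : 2 * Y n.+1 <= 1 + \sum_(k < n.+2) convol y y k.
  rewrite YE mulr_sumr [X in _ + X]big_ord_recl convol0 mul0r add0r.
  apply: (@le_trans _ _ (\sum_(k < n.+1) (`|W k.+1| * r ^+ k.+1 + convol y y k.+1))).
    by apply: ler_sum => k _; exact: step.
  by rewrite big_split lerD2r.
(* Since [y 0] is 0, the square involves [Y] only up to index [n], where it is at most 1 by
   induction; hence $2Y_{n+1} \le 1+Y_n \le 2$. *)
rewrite sum_convol big_ord_recr /= subnn big_ord1 mulr0 addr0.
have : \sum_(i < n.+1) y i * Y (n.+1 - i)%N <= Y n.
  apply: ler_sum => -[[|i] /= lin] _; first by rewrite mul0r.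
  by rewrite ler_piMr ?(y0 i.+1) // IHn // subSS ltnS leq_subr.
have := IHn n (ltnSn n); rewrite /Y; lra.
Qed.

Variable rho : R.
Hypothesis rho_gt0 : 0 < rho.
Hypothesis rho_root : rho ^+ 3 + rho ^+ 2 + 3 * rho = 1.
Let B := root_cofactor rho.
Let W := cofactor_discr rho.

Let rho_lt : 3 * rho < 1.
Proof.
move: rho_root (exprn_gt0 2 rho_gt0) (exprn_gt0 3 rho_gt0).
set a := rho ^+ 3; set b := rho ^+ 2; lra.
Qed.

Let rho_neq0 : rho != 0. Proof. by rewrite gt_eqF. Qed.

(** The constant 2 is chosen for $\sum_{k\ge1} 2\cdot 3^{-k}=1$, as [sqrt_series_bound] demands at
    radius $1/3$. *)
Lemma cofactor_discr_bound n : `|W n.+1| <= 2.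
Proof.
have r2 : rho ^+ 2 + 2 * rho <= 1.
  have : rho ^+ 2 <= rho * (1 / 3) by rewrite expr2 ler_wpM2l ?ltW //; have := rho_lt; lra.
  by have := rho_lt; lra.
have c3 : 3 <= rho^-1 by rewrite -[3]invrK lef_pV2 ?posrE //; have := rho_lt; lra.
have c4 : rho^-1 + rho <= 4.
  (* Replacing 1 through the equation of [rho] turns $1+\rho^2 \le 4\rho$ into this inequality. *)
  have : rho * (rho ^+ 2 + 2 * rho) <= rho by rewrite ler_piMr // ltW.
  move=> h; rewrite -(ler_pM2l rho_gt0) mulrDr divff //.
  have e : rho * (rho ^+ 2 + 2 * rho) = rho ^+ 3 + 2 * rho ^+ 2 by ring.
  move: rho_root h; rewrite e -expr2.
  set a := rho ^+ 3; set b := rho ^+ 2; lra.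
by rewrite /W; case: n => [|n] /=; rewrite ger0_norm; have := rho_gt0; lra.
Qed.

Lemma root_cofactor0 : B 0%N = 1.
Proof. by rewrite /B /root_cofactor !convol0 /sqrt_one_sub /geom /= !expr0 !mulr1. Qed.

Lemma sum_root_cofactor n : \sum_(k < n) `|B k.+1| * 3^-1 ^+ k.+1 <= 1.
Proof.
apply: (sqrt_series_bound _ _ (convol_root_cofactor rho_neq0 rho_root)) => //.
  exact: root_cofactor0.
move=> {}n; rewrite (_ : cofactor_discr rho = W) //.
have : \sum_(k < n) 2 * 3^-1 ^+ k.+1 = 1 - 3^-1 ^+ n :> R.
  elim: n => [|n IHn]; first by rewrite big_ord0 expr0 subrr.
  by rewrite big_ord_recr /= IHn exprS; field.
move=> e; apply: (@le_trans _ _ (\sum_(k < n) 2 * 3^-1 ^+ k.+1)).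
  by apply: ler_sum => k _; rewrite ler_wpM2r ?exprn_ge0 ?cofactor_discr_bound.
by rewrite e gerBl exprn_ge0.
Qed.

(** Coefficients of $B(\rho z)$: the singularity moves to 1, and the sum of the series is
    $B(\rho)$. *)
Let beta (k : nat) : R := B k * rho ^+ k.

Lemma sum_norm_beta n : \sum_(k < n) `|beta k.+1| <= 1.
Proof.
apply: le_trans (sum_root_cofactor n); apply: ler_sum => k _.
rewrite normrM ler_wpM2l // (ger0_norm (exprn_ge0 _ (ltW rho_gt0))).
by rewrite lerXn2r // ?nnegrE ?(ltW rho_gt0) //; have := rho_lt; lra.
Qed.

(** The gap between $\rho$ and $1/3$ absorbs the polynomial factor: with $x=\sqrt{3\rho}<1$,
    $\rho^k=x^{2k}3^{-k}$ and $(k+1)x^k \le 1+x+\dots+x^k \le 1/(1-x)$. *)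
Lemma cvg_beta_weighted :
  cvgn (series (fun k => k.+1%:R ^+ 2 * `|beta k|)).
Proof.
pose x := Num.sqrt (3 * rho).
have x01 : 0 <= x < 1.
  rewrite sqrtr_ge0 /= -sqrtr1 ltr_sqrt //.
have x2 : x ^+ 2 = 3 * rho by rewrite sqr_sqrtr //; rewrite mulr_ge0 // ltW.
have kx k : k.+1%:R * x ^+ k <= (1 - x)^-1.
  case/andP: x01 => x0 x1.
  apply: (@le_trans _ _ (\sum_(i < k.+1) x ^+ i)).
    rewrite mulr_natl -[X in _ *+ X]card_ord -sumr_const.
    by apply: ler_sum => i _; apply: ler_wiXn2l => //; rewrite ?ltW // -ltnS.
  rewrite -[leRHS]mul1r ler_pdivlMr ?subr_gt0 //.
  have -> : (\sum_(i < k.+1) x ^+ i) * (1 - x) = 1 - x ^+ k.+1.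
    have := subrX1 x k.+1; set S := \sum_(i < _) _ => h.
    by rewrite -[LHS]opprK -mulrN opprB mulrC -h opprB.
  by rewrite gerBl exprn_ge0.
pose K := (1 - x)^-1 ^+ 2.
have K0 : 0 <= K by exact: sqr_ge0.
have le_g k : k.+1%:R ^+ 2 * `|beta k| <= K * (`|B k| * 3^-1 ^+ k).
  have -> : k.+1%:R ^+ 2 * `|beta k| = (k.+1%:R * x ^+ k) ^+ 2 * (`|B k| * 3^-1 ^+ k).
    rewrite normrM (ger0_norm (exprn_ge0 _ (ltW rho_gt0))).
    have -> : rho ^+ k = (x ^+ k) ^+ 2 * 3^-1 ^+ k.
      by rewrite exprAC x2 -exprMn mulrAC divff ?mul1r.
    by ring.
  apply: ler_wpM2r; first by rewrite mulr_ge0 ?exprn_ge0.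
  case/andP: x01 => x0 x1; rewrite lerXn2r ?nnegrE //.
    by rewrite mulr_ge0 ?exprn_ge0 ?ler0n.
  by rewrite invr_ge0 subr_ge0 ltW.
apply: (series_le_cvg _ _ le_g).
- by move=> k; rewrite mulr_ge0 ?sqr_ge0.
- by move=> k; rewrite mulr_ge0 // mulr_ge0 ?exprn_ge0.
apply: is_cvg_seriesZ; apply: nondecreasing_is_cvgn.
  apply/nondecreasing_seqP => n; rewrite seriesSr lerDl.
  by rewrite mulr_ge0 ?exprn_ge0.
exists (`|B 0%N| + 1) => _ [[|n] _ <-].
  by rewrite seriesEord /= big_ord0 addr_ge0.
rewrite seriesEord /= big_ord_recl expr0 mulr1 lerD2l.
exact: sum_root_cofactor.
Qed.

Lemma cvg_norm_beta : cvgn (series (fun k => `|beta k|)).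
Proof.
apply: (series_le_cvg _ _ _ cvg_beta_weighted) => [//|k|k].
  by rewrite mulr_ge0 ?sqr_ge0.
by rewrite ler_peMl // exprn_ege1 // ler1n.
Qed.

(** Selects the sign of the square root of $W(\rho)$: [beta 0] is 1 and the other terms have total
    absolute value at most 1. *)
Lemma lim_beta_ge0 : 0 <= limn (series beta).
Proof.
apply: limr_ge; first exact/normed_cvg/cvg_norm_beta.
exists 1%N => // -[//|n] _ /=.
rewrite seriesEord /= big_ord_recl /beta root_cofactor0 expr0 mulr1 -/beta.
have : `|\sum_(k < n) beta k.+1| <= 1.
  exact: le_trans (ler_norm_sum _ _ _) (sum_norm_beta n).
by rewrite ler_norml => /andP[+ _]; rewrite -(lerD2l 1) subrr.
Qed.

(** The limit is $B(\rho)^2=W(\rho)$. As [W] is constant from index 2 on, its partial sums at $\rho$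
    have a closed form with a geometric remainder. *)
Lemma lim_beta_sqr :
  limn (series beta) ^+ 2 = rho * ((3 * rho ^+ 2 + 2 * rho + 3) / (1 - rho)).
Proof.
have rho1 : 1 - rho != 0 by rewrite gt_eqF // subr_gt0; have := rho_lt; lra.
set Q := RHS.
have sumW n : \sum_(k < n.+3) convol beta beta k =
    Q - (rho^-1 - 2 + rho) * rho ^+ 3 / (1 - rho) * rho ^+ n.
  have wE k : convol beta beta k = W k * rho ^+ k.
    by rewrite convol_scale convol_root_cofactor.
  under eq_bigr do rewrite wE.
  elim: n => [|n IHn].
    rewrite !big_ord_recr big_ord0 /= /Q /W /= add0r !expr0.
    apply/subr0_eq.
    transitivity (2 * (1 - (rho ^+ 3 + rho ^+ 2 + 3 * rho)) / (1 - rho)).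
      by field; rewrite rho1.
    by rewrite rho_root subrr mulr0 mul0r.
  by rewrite big_ord_recr /= IHn /W /= !exprS; field; rewrite rho1.
have cvgQ : \sum_(k < n.+1) convol beta beta k @[n --> \oo] --> Q.
  have h : Q - (rho^-1 - 2 + rho) * rho ^+ 3 / (1 - rho) * rho ^+ n @[n --> \oo] --> Q - 0.
    apply: cvgB; first exact: cvg_cst.
    apply: cvg_geometric.
    by rewrite ger0_norm ?(ltW rho_gt0) //; have := rho_lt; have := rho_gt0; lra.
  rewrite subr0 in h; rewrite -(cvg_shiftn 2).
  by under eq_fun do rewrite addn2 sumW.
by rewrite -(cvg_lim _ (cvg_sum_convol cvg_norm_beta)) // (cvg_lim _ cvgQ).
Qed.

(** * Transfer of the asymptotics through the Cauchy product *)

Let s : nat -> R := sqrt_coef.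

(** Raise $n+1 \le (k+1)(n-k+1)$ to the power $3/2$ and round $(k+1)^{3/2}$ up to $(k+1)^2$. This
    supplies the dominating series in [cvg_convol_beta]. *)
Lemma weight_le (n k : nat) : (k <= n)%N ->
  weight n <= k.+1%:R ^+ 2 * weight (n - k) :> R.
Proof.
move=> kn; rewrite /weight expr2 mulrACA.
have le_n : (n.+1 <= k.+1 * (n - k).+1)%N by nia.
apply: ler_pM; rewrite ?sqrtr_ge0 //; first by rewrite -natrM ler_nat.
have -> : k.+1%:R = Num.sqrt (k.+1%:R ^+ 2) :> R by rewrite sqrtr_sqr ger0_norm.
rewrite -sqrtrM ?sqr_ge0 // ler_wsqrtr // -natrX -natrM ler_nat.
by apply: (leq_trans le_n); rewrite leq_mul2r; nia.
Qed.

Lemma cvg_sqrt_coef_shift (k : nat) :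
  s (n - k)%N * weight n @[n --> \oo] --> - (2 * @gamma_half R 0)^-1.
Proof.
(* Beyond index [k] the truncated subtraction is exact; the extra 1 reaches the form [s n.+1]. *)
rewrite -(cvg_shiftn k.+1).
have h : s n.+1 * weight n * (weight (n + k.+1) / weight n) @[n --> \oo] -->
    - (2 * @gamma_half R 0)^-1 * 1.
  by apply: cvgM; [exact: cvg_sqrt_coef|exact: cvg_weight_ratio].
rewrite mulr1 in h; apply: cvg_trans h; apply: near_eq_cvg; apply: nearW => n.
transitivity (s (n + k.+1 - k)%N * weight (n + k.+1)); last by [].
have -> : (n + k.+1 - k = n.+1)%N by lia.
by field; rewrite gt_eqF // weight_gt0.
Qed.

Lemma cvg_convol_beta :
  convol beta s n * weight n @[n --> \oo]
    --> - limn (series beta) / (2 * gamma_half 0).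
Proof.
have [K [K0 sK]] : exists K : R, 0 <= K /\ forall n, `|s n| * weight n <= K.
  have := cvg_sqrt_coef_shift 0; under eq_fun do rewrite subn0.
  move=> /(cvgP _)/cvg_seq_bounded[M [_ /(_ (M + 1))]].
  rewrite ltrDl ltr01 => /(_ isT) hM; exists (M + 1).
  have hM' n : `|s n| * weight n <= M + 1.
    by rewrite -{1}(gtr0_norm (weight_gt0 n)) -normrM; exact: hM.
  by split => //; apply: le_trans (hM' 0%N); rewrite mulr_ge0 // ltW // weight_gt0.
have [|||cl] := @tannery _ (fun n k => beta k * s (n - k)%N * weight n)
    (fun k => K * (k.+1%:R ^+ 2 * `|beta k|))
    (fun k => - (2 * gamma_half 0)^-1 * beta k).
- move=> n k kn; rewrite normrM (gtr0_norm (weight_gt0 n)) normrM.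
  have -> : K * (k.+1%:R ^+ 2 * `|beta k|) = `|beta k| * (k.+1%:R ^+ 2 * K) by ring.
  rewrite -mulrA ler_wpM2l //.
  apply: (@le_trans _ _ (`|s (n - k)%N| * (k.+1%:R ^+ 2 * weight (n - k)))).
    by rewrite ler_wpM2l // weight_le.
  by rewrite mulrCA ler_wpM2l ?sqr_ge0.
- by apply: is_cvg_seriesZ; exact: cvg_beta_weighted.
- move=> k; rewrite mulrC; under eq_fun do rewrite -mulrA.
  by apply: cvgM; [exact: cvg_cst|exact: cvg_sqrt_coef_shift].
have -> : limn (series (fun k => - (2 * gamma_half 0)^-1 * beta k)) =
    - limn (series beta) / (2 * gamma_half 0).
  rewrite (lim_seriesZ (- (2 * gamma_half 0)^-1) (normed_cvg cvg_norm_beta)).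
  transitivity (- (2 * gamma_half 0)^-1 * limn (series beta)); first by [].
  by rewrite !mulNr mulrC.
by under eq_fun do rewrite -mulr_suml.
Qed.

(** The coefficient of $z^{n+2}$ in $F$ is $-2L_{n+1}$; the resulting shift of the weight by 2 is
    harmless since the ratio of weights tends to 1. *)
Lemma cvg_L_weighted :
  (L n.+1)%:R * rho ^+ n.+1 * weight n @[n --> \oo]
    --> limn (series beta) / (4 * rho * gamma_half 0).
Proof.
have LE n : (L n.+1)%:R * rho ^+ n.+1 = - (2 * rho)^-1 * convol beta s n.+2 :> R.
  have <- : root_discr n.+2 * rho ^+ n.+2 = convol beta s n.+2.
    rewrite -(convol_sqrt_root_cofactor rho) -convol_scale convolC.
    congr convol; apply/funext => k.
    by rewrite /sqrt_one_sub -mulrA -exprMn mulVf // expr1n mulr1.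
  by rewrite /= [rho ^+ n.+2]exprS; field.
have h : - (2 * rho)^-1 * (convol beta s n.+2 * weight n.+2) *
    (weight (n + 2)%N / weight n)^-1 @[n --> \oo] -->
    - (2 * rho)^-1 * (- limn (series beta) / (2 * gamma_half 0)) * 1^-1.
  apply: cvgM; last by apply: cvgV; [exact: oner_neq0|exact: cvg_weight_ratio].
  apply: cvgM; first exact: cvg_cst.
  have := cvg_convol_beta; rewrite -(cvg_shiftn 2).
  by under eq_fun do rewrite addn2.
have -> : limn (series beta) / (4 * rho * gamma_half 0) =
    - (2 * rho)^-1 * (- limn (series beta) / (2 * gamma_half 0)) * 1^-1.
  by rewrite invr1; field; rewrite rho_neq0 gt_eqF // gamma_half_gt0.
apply: cvg_trans h; apply: near_eq_cvg; apply: nearW => n.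
rewrite LE addn2; field.
by rewrite !gt_eqF // weight_gt0.
Qed.

End Cofactor.

Theorem theorem1 (R : realType) (rho C : R)
  (hrho : smallest_positive_root (1 - 3 * 'X - 'X^2 - 'X^3) rho)
  (hC : C = - Num.sqrt (rho * ((3 * rho ^+ 2 + 2 * rho + 3) / (1 - rho)))
            / (2 * rho * Gamma (- (1 / 2)))) :
  (fun n : nat => (L n)%:R : R) ~_\oo
  (fun n : nat => (1 / rho) ^+ n * (C / n%:R `^ (3 / 2))).
Proof.
have [rho_gt0 /rootP rho_root _] := hrho.
have rho_root' : rho ^+ 3 + rho ^+ 2 + 3 * rho = 1.
  move: rho_root; rewrite !hornerE /= => e; apply/esym/subr0_eq; rewrite -[RHS]e; ring.
pose S := limn (series (fun k => root_cofactor rho k * rho ^+ k)).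
have S0 : 0 <= S by exact: lim_beta_ge0.
have S2 := lim_beta_sqr rho_gt0 rho_root'; rewrite -/S in S2.
have g0 := @gamma_half_gt0 R 0.
have CE : C = S / (4 * rho * gamma_half 0).
  rewrite hC -S2 sqrtr_sqr (ger0_norm S0) Gamma_neg_half.
  by field; rewrite !gt_eqF.
(* Makes [e * |C|] a positive tolerance, turning convergence to [C] into a relative error bound. *)
have C_neq0 : C != 0.
  have rho1 : 0 < 1 - rho.
    move: rho_root' (exprn_gt0 2 rho_gt0) (exprn_gt0 3 rho_gt0).
    set a := rho ^+ 3; set b := rho ^+ 2; lra.
  rewrite CE mulf_neq0 ?invr_neq0 //; last by rewrite !mulf_neq0 // gt_eqF.
  rewrite -sqrf_eq0 S2 gt_eqF // mulr_gt0 // divr_gt0 //.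
  by rewrite !addr_gt0 // mulr_gt0 // exprn_gt0.
apply/eqaddoP => e e0.
have cvgL := cvg_L_weighted rho_gt0 rho_root'; rewrite -/S -CE in cvgL.
have eC : 0 < e * `|C| by rewrite mulr_gt0 // normr_gt0.
have /cvgrPdist_le/(_ _ eC)[N _ hN] := cvgL.
(* Starting at index 1 allows $(n+1)^{3/2}$ to be read as [weight n]. *)
exists N.+1 => // -[//|n] /= Nn.
have := hN n Nn; rewrite /=.
have wE : n.+1%:R `^ (3 / 2) = weight n :> R.
  have -> : 3 / 2 = 1 + 2^-1 :> R by field.
  by rewrite powRD ?pnatr_eq0 ?implybT // powRr1 ?ler0n // powR12_sqrt ?ler0n.
have w0 := @weight_gt0 R n.
set u := (1 / rho) ^+ n.+1 / weight n => h.
suff : `|(L n.+1)%:R - (1 / rho) ^+ n.+1 * (C / n.+1%:R `^ (3 / 2))| <=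
    e * `|(1 / rho) ^+ n.+1 * (C / n.+1%:R `^ (3 / 2))| by [].
have -> : (1 / rho) ^+ n.+1 * (C / n.+1%:R `^ (3 / 2)) = u * C.
  by rewrite wE /u mulrA mulrAC.
have -> : (L n.+1)%:R - u * C = - u * (C - (L n.+1)%:R * rho ^+ n.+1 * weight n).
  rewrite /u mul1r exprVn; field; by rewrite !gt_eqF ?exprn_gt0.
by rewrite normrM normrN (normrM u) [leRHS]mulrCA ler_wpM2l.
Qed.
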